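(* The reducibilities $\le_{c_1}$ and $\le_{c_{1,N}}$ do not coincide on the computably enumerable sets; that is, there exist computably enumerable sets $X, Y \subseteq \omega$ such that $X \le_{c_1} Y$ but $X \not\le_{c_{1,N}} Y$.
   Context: $\omega$ is the set of natural numbers and $D_u$ denotes the finite set with canonical index $u$. For sets $X, Y \subseteq \omega$: - A $c$-reduction from $X$ to $Y$ is a (total) computable function $f$ such that for all $x$: $x \in X \iff D_{f(x)} \subseteq Y$. - $X \le_{c_1} Y$ if there is a $c_1$-reduction from $X$ to $Y$, i.e. a $c$-reduction $f$ from $X$ to $Y$ such that $x \neq y$ implies $D_{f(x)} \cap D_{f(y)} = \emptyset$. - $X \le_{c_{1,N}} Y$ if there is a $c_1$-reduction $f$ from $X$ to $Y$ such that the set $R_f = \bigcup_{x \in \omega} D_{f(x)}$ is computable. *)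

(* Defs.v *)
From mathcomp Require Import all_boot.
From mathcomp Require Import classical_sets.

Set Implicit Arguments.
Unset Strict Implicit.
Unset Printing Implicit Defensive.

Local Open Scope classical_set_scope.

(** Codes for the partial (mu-)recursive functions.  Codes carry no arity:
    they act on finite lists of arguments, a missing argument being read as 0
    and a superfluous one being ignored, which does not change the class of
    unary partial functions that they define. *)
Inductive code : Type :=
| Zero
| Succ
| Proj of nat
| Comp of code & seq code
| Prec of code & code
| Mu of code.

(** [eval c v y]: on the arguments [v] the computation of [c] halts with
    output [y].  [Prec f g] recurses on its first argument:
    [h (0, v) = f v] and [h (n + 1, v) = g (n, h (n, v), v)].
    [Mu f] at [v] is the least [y] such that [f (y, v) = 0], where
    [f (i, v)] must be defined for all [i < y]. *)
Fixpoint eval (c : code) (v : seq nat) (y : nat) {struct c} : Prop :=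
  match c with
  | Zero => y = 0
  | Succ => y = (nth 0 v 0).+1
  | Proj i => y = nth 0 v i
  | Comp f gs =>
      exists ws : seq nat,
        (fix evals (gs : seq code) (ws : seq nat) {struct gs} : Prop :=
           match gs, ws with
           | [::], [::] => True
           | g :: gs', w :: ws' => eval g v w /\ evals gs' ws'
           | _, _ => False
           end) gs ws
        /\ eval f ws y
  | Prec f g =>
      (fix rec (n : nat) (y : nat) {struct n} : Prop :=
         match n with
         | 0 => eval f (behead v) y
         | m.+1 => exists z, rec m z /\ eval g [:: m, z & behead v] y
         end) (nth 0 v 0) y
  | Mu f =>
      eval f (y :: v) 0 /\
      forall i, i < y -> exists z, eval f (i :: v) z.+1
  end.

Definition computable_fun (f : nat -> nat) : Prop :=
  exists c : code, forall x y, eval c [:: x] y <-> f x = y.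

Definition computable_set (A : set nat) : Prop :=
  exists chi : nat -> bool,
    computable_fun (fun x => nat_of_bool (chi x)) /\
    forall x, A x <-> chi x.

Definition ce_set (A : set nat) : Prop :=
  exists c : code, forall x, A x <-> exists y, eval c [:: x] y.

(** The finite set with canonical index [u]: [u] is the sum of the [2 ^ x]
    for [x] in the set, so membership is a binary digit of [u]. *)
Definition D (u : nat) : set nat := [set x | odd (u %/ 2 ^ x)].

Definition c_reduction (X Y : set nat) (f : nat -> nat) : Prop :=
  computable_fun f /\ forall x, X x <-> D (f x) `<=` Y.

Definition c1_reduction (X Y : set nat) (f : nat -> nat) : Prop :=
  c_reduction X Y f /\
  forall x y, x <> y -> D (f x) `&` D (f y) = set0.

Definition le_c1 (X Y : set nat) : Prop :=
  exists f, c1_reduction X Y f.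

Definition le_c1N (X Y : set nat) : Prop :=
  exists f, c1_reduction X Y f /\ computable_set (\bigcup_x D (f x)).

(* Main.v *)
Require Import Defs.
From mathcomp Require Import all_boot zify.
From mathcomp Require Import boolp classical_sets.

Set Implicit Arguments.
Unset Strict Implicit.
Unset Printing Implicit Defensive.

(** The complement of [Y] is the set of limit positions [y_0 < y_1 < ...] of
    movable markers, where [y_(k+1)] is pushed beyond the least halting witness
    of every program [e <= y_k] that halts on [y_k].  So if [y < y'] are large
    elements outside [Y], any given partial computable function maps [y] below
    [y'].  Let [W] be the set of those [y] that are found to carry a marker [k]
    such that the program coded by the first component of [k] outputs 0 on [y].
    Each [y] in [W] gets the unique [x = (y, s)], [s] being the stage at which
    [y] enters [W]; the reduction sends this [x] to [{y}] and all other numbers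
    to the empty set, and [X] is the preimage of [Y].

    Let [f] be a c1-reduction from [X] to [Y] with computable range [R_f].  For
    [x] outside [X], with associated [y], pick [z] in [D_(f x)] outside [Y].
    Now [y <= x] is computable from [z] (search for the owner [x] of [z]), and
    [z < f x] is computable from [y], so [z < y] and [y < z] both contradict
    domination, up to finitely many [x]: hence [z = y].  Thus the computable set
    of the [z] in [R_f] whose owner is sent to [{z}] agrees with [W] on almost
    all numbers outside [Y], and a marker whose index codes a decision procedure
    for this set refutes that. *)

(** * Closure properties of the total recursive functions *)

Definition recursive (F : seq nat -> nat) : Prop :=
  exists c, forall v y, eval c v y <-> y = F v.

Fixpoint evals (gs : seq code) (v ws : seq nat) : Prop :=
  match gs, ws with
  | [::], [::] => True
  | g :: gs', w :: ws' => eval g v w /\ evals gs' v ws'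
  | _, _ => False
  end.

Lemma eval_Comp f gs v y :
  eval (Comp f gs) v y <-> exists ws, evals gs v ws /\ eval f ws y.
Proof.
have E : forall ws, (fix evals (gs : seq code) (ws : seq nat) {struct gs} : Prop :=
           match gs, ws with
           | [::], [::] => True
           | g :: gs', w :: ws' => eval g v w /\ evals gs' ws'
           | _, _ => False
           end) gs ws <-> evals gs v ws.
  by elim: gs => [|g gs IH] [|w ws] //=; rewrite IH.
by split=> -[ws [/E gsw fy]]; exists ws.
Qed.

Lemma recursive_ext F G : F =1 G -> recursive F -> recursive G.
Proof. by move=> FG [c cF]; exists c => v y; rewrite cF FG. Qed.

Lemma recursive_comp G (Fs : seq (seq nat -> nat)) :
  recursive G -> (forall i, i < size Fs -> recursive (nth (fun=> 0) Fs i)) ->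
  recursive (fun v => G [seq F v | F <- Fs]).
Proof.
move=> [c cG] rFs.
have [gs gsP] : exists gs, forall v ws,
    evals gs v ws <-> ws = [seq F v | F <- Fs].
  elim: Fs rFs => [|F Fs IH] rFs; first by exists [::] => v [].
  have [gs gsP] : exists gs, forall v ws,
      evals gs v ws <-> ws = [seq F v | F <- Fs].
    by apply: IH => i ?; exact: (rFs i.+1).
  have [g gP] := rFs 0 isT.
  exists (g :: gs) => v [|w ws] //=; rewrite gsP gP.
  by split=> [[-> ->]|[-> ->]].
exists (Comp c gs) => v y; rewrite eval_Comp.
split=> [[ws [/gsP -> /cG //]]|->].
by exists [seq F v | F <- Fs]; split; [exact/gsP|exact/cG].
Qed.

Definition recursive1 (g : nat -> nat) := recursive (fun v => g (nth 0 v 0)).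
Definition recursive2 (g : nat -> nat -> nat) :=
  recursive (fun v => g (nth 0 v 0) (nth 0 v 1)).
Definition recursive3 (g : nat -> nat -> nat -> nat) :=
  recursive (fun v => g (nth 0 v 0) (nth 0 v 1) (nth 0 v 2)).

Lemma recursive_comp1 g F :
  recursive1 g -> recursive F -> recursive (fun v => g (F v)).
Proof. by move=> rg rF; apply: (recursive_comp (Fs := [:: F]) rg) => -[|]. Qed.

Lemma recursive_comp2 g F1 F2 : recursive2 g ->
  recursive F1 -> recursive F2 -> recursive (fun v => g (F1 v) (F2 v)).
Proof.
move=> rg rF1 rF2.
by apply: (recursive_comp (Fs := [:: F1; F2]) rg) => -[|[|]].
Qed.

Lemma recursive_comp3 g F1 F2 F3 : recursive3 g ->
  recursive F1 -> recursive F2 -> recursive F3 ->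
  recursive (fun v => g (F1 v) (F2 v) (F3 v)).
Proof.
move=> rg rF1 rF2 rF3.
by apply: (recursive_comp (Fs := [:: F1; F2; F3]) rg) => -[|[|[|]]].
Qed.

(** Under [k] nested binders the outer environment is [iter k behead v]; the instances below have
    the form that proof search meets. *)
Lemma recursive_nth k i : recursive (fun v => nth 0 (iter k behead v) i).
Proof.
exists (Proj (k + i)) => v y /=.
suff -> : nth 0 (iter k behead v) i = nth 0 v (k + i) by [].
elim: k i => [|k IH] i //=; by rewrite nth_behead IH addnS addSn.
Qed.
Definition recursive_nth0 i : recursive (fun v => nth 0 v i) :=
  recursive_nth 0 i.
Definition recursive_nth1 i : recursive (fun v => nth 0 (behead v) i) :=
  recursive_nth 1 i.
Definition recursive_nth2 i :
  recursive (fun v => nth 0 (behead (behead v)) i) := recursive_nth 2 i.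
Definition recursive_nth3 i :
  recursive (fun v => nth 0 (behead (behead (behead v))) i) := recursive_nth 3 i.
Definition recursive_nth4 i :
  recursive (fun v => nth 0 (behead (behead (behead (behead v)))) i) :=
  recursive_nth 4 i.

Lemma recursive_succ F : recursive F -> recursive (fun v => (F v).+1).
Proof. by apply: recursive_comp1; exists Succ. Qed.

Lemma recursive_const n : recursive (fun=> n).
Proof. by elim: n => [|n IH]; [exists Zero|exact: recursive_succ]. Qed.

Lemma recursive_pred F : recursive F -> recursive (fun v => (F v).-1).
Proof.
apply: recursive_comp1; exists (Prec Zero (Proj 0)) => v y /=.
case: (nth 0 v 0) => [|m] //=; split=> [[z [_ ->]]//|->].
by elim: m => [|m [z [hz _]]]; [exists 0|exists m; split=> //; exists z].
Qed.

Lemma recursive_iter g b N S : recursive2 g -> recursive1 b ->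
  recursive N -> recursive S ->
  recursive (fun v => iter (N v) (g (S v)) (b (S v))).
Proof.
move=> rg [cb cbP] rN rS.
apply: (recursive_comp2 (g := fun n s => iter n (g s) (b s))) => //.
(* The step code receives [[:: m, z & behead v]]: the value so far is at position 1, the parameter
   at position 2. *)
have [cg cgP] : recursive (fun v => g (nth 0 v 2) (nth 0 v 1)).
  by apply: recursive_comp2 => //; exact: recursive_nth0.
exists (Prec cb cg) => v y /=.
elim: (nth 0 v 0) y => [|n IH] y /=; first by rewrite cbP nth_behead.
split=> [[z [/IH -> /cgP ->]]|->].
  by rewrite /= nth_behead.
exists (iter n (g (nth 0 v 1)) (b (nth 0 v 1))); split; first exact/IH.
by apply/cgP; rewrite /= nth_behead.
Qed.

Lemma recursive_add F G :
  recursive F -> recursive G -> recursive (fun v => F v + G v).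
Proof.
move=> rF rG; apply: (@recursive_ext (fun v => iter (F v) succn (G v))).
  by move=> v; rewrite iter_succn addnC.
apply: (recursive_iter (g := fun=> succn) (b := id)) => //.
- exact/recursive_succ/recursive_nth0.
- exact: recursive_nth0.
Qed.

Lemma recursive_sub F G :
  recursive F -> recursive G -> recursive (fun v => F v - G v).
Proof.
move=> rF rG; apply: (@recursive_ext (fun v => iter (G v) predn (F v))).
  by move=> v; rewrite iter_predn.
apply: (recursive_iter (g := fun=> predn) (b := id)) => //.
- exact/recursive_pred/recursive_nth0.
- exact: recursive_nth0.
Qed.

Lemma recursive_mul F G :
  recursive F -> recursive G -> recursive (fun v => F v * G v).
Proof.
move=> rF rG; apply: (@recursive_ext (fun v => iter (G v) (addn (F v)) 0)).
  by move=> v; rewrite iter_addn addn0.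
apply: (recursive_iter (g := addn) (b := fun=> 0)) => //.
- by apply: recursive_add; exact: recursive_nth0.
- exact: recursive_const.
Qed.

Lemma recursive_exp F G :
  recursive F -> recursive G -> recursive (fun v => F v ^ G v).
Proof.
move=> rF rG; apply: (@recursive_ext (fun v => iter (G v) (muln (F v)) 1)).
  by move=> v; rewrite iter_muln muln1.
apply: (recursive_iter (g := muln) (b := fun=> 1)) => //.
- by apply: recursive_mul; exact: recursive_nth0.
- exact: recursive_const.
Qed.

Lemma recursive_negb (P : seq nat -> bool) :
  recursive P -> recursive (fun v => ~~ P v).
Proof.
move=> rP; apply: (@recursive_ext (fun v => 1 - P v)) => [v|].
  by case: (P v).
exact/recursive_sub/rP/recursive_const.
Qed.

Lemma recursive_andb (P Q : seq nat -> bool) :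
  recursive P -> recursive Q -> recursive (fun v => P v && Q v).
Proof.
move=> rP rQ; apply: (@recursive_ext (fun v => P v * Q v)) => [v|].
  by rewrite mulnb.
exact: recursive_mul.
Qed.

Lemma recursive_orb (P Q : seq nat -> bool) :
  recursive P -> recursive Q -> recursive (fun v => P v || Q v).
Proof.
move=> rP rQ; apply: (@recursive_ext (fun v => ~~ (~~ P v && ~~ Q v))) => [v|].
  by rewrite negb_and !negbK.
by apply/recursive_negb/recursive_andb; exact: recursive_negb.
Qed.

Lemma recursive_implb (P Q : seq nat -> bool) :
  recursive P -> recursive Q -> recursive (fun v => P v ==> Q v).
Proof.
move=> rP rQ; apply: (@recursive_ext (fun v => ~~ P v || Q v)) => [v|].
  by rewrite implybE.
exact/recursive_orb/rQ/recursive_negb.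
Qed.

Lemma recursive_leq F G :
  recursive F -> recursive G -> recursive (fun v => F v <= G v).
Proof.
move=> rF rG; apply: (@recursive_ext (fun v => 1 - (F v - G v))) => [v|].
  by rewrite /leq; case: (F v - G v) => [|[]].
by apply: recursive_sub; [exact: recursive_const|exact: recursive_sub].
Qed.

Lemma recursive_eqn F G :
  recursive F -> recursive G -> recursive (fun v => F v == G v).
Proof.
move=> rF rG.
apply: (@recursive_ext (fun v => (F v <= G v) && (G v <= F v))) => [v|].
  by rewrite eqn_leq.
by apply: recursive_andb; exact: recursive_leq.
Qed.

Lemma recursive_if (P : seq nat -> bool) F G :
  recursive P -> recursive F -> recursive G ->
  recursive (fun v => if P v then F v else G v).
Proof.
move=> rP rF rG.
apply: (@recursive_ext (fun v => P v * F v + ~~ P v * G v)) => [v|].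
  by case: (P v); rewrite ?mul1n ?mul0n ?addn0.
apply: recursive_add; apply: recursive_mul => //.
exact: recursive_negb.
Qed.

(* The environment [v] of a bound variable is reached from the environment
   [i :: v] of its scope as [behead (i :: v)]. *)
Lemma eval_Mu (p : nat -> seq nat -> bool) :
  recursive (fun w => p (nth 0 w 0) (behead w)) ->
  exists c, forall v y,
    eval c v y <-> p y v /\ forall i, i < y -> ~~ p i v.
Proof.
move/recursive_negb => [c cP]; exists (Mu c) => v y /=.
rewrite cP /=; split=> [[pyv lt_y]|[pyv lt_y]].
  split=> [|i /lt_y [z /cP/=]]; first by move: pyv; case: (p y v).
  by case: (p i v).
by split=> [|i /lt_y npi]; [rewrite pyv|exists 0; apply/cP; rewrite /= npi].
Qed.

Lemma recursive_mu (p : nat -> seq nat -> bool) F :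
  recursive (fun w => p (nth 0 w 0) (behead w)) ->
  (forall v, p (F v) v /\ forall i, i < F v -> ~~ p i v) -> recursive F.
Proof.
move=> /eval_Mu [c cP] pF; exists c => v y; rewrite cP.
split=> [[py ltpy]|->]; last exact: pF.
have [pFv ltpF] := pF v.
by case: (ltngtP y (F v)) => // [/ltpF|/ltpy]; rewrite ?py ?pFv.
Qed.

(** * Bounded search and bounded quantifiers *)

Definition bmin n (p : pred nat) := find p (iota 0 n).
Definition bex n (p : pred nat) := has p (iota 0 n).
Definition ball n (p : pred nat) := all p (iota 0 n).

Lemma bexP n (p : pred nat) : reflect (exists2 i, i < n & p i) (bex n p).
Proof.
apply: (iffP hasP) => -[i]; first by rewrite mem_iota => /andP[_ ?]; exists i.
by move=> ? ?; exists i; rewrite // mem_iota.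
Qed.

Lemma ballP n (p : pred nat) : reflect (forall i, i < n -> p i) (ball n p).
Proof.
apply: (iffP allP) => H i; first by move=> ?; apply: H; rewrite mem_iota.
by rewrite mem_iota => /andP[_]; exact: H.
Qed.

Lemma bmin_le n p : bmin n p <= n.
Proof. by rewrite -[leqRHS](size_iota 0); exact: find_size. Qed.

Lemma bmin_before n p i : i < bmin n p -> ~~ p i.
Proof.
move=> lti; have := before_find 0 lti; rewrite nth_iota ?add0n => [->//|].
exact: leq_trans lti (bmin_le n p).
Qed.

Lemma bmin_sat n p : bmin n p < n -> p (bmin n p).
Proof.
move=> lt; have hp : has p (iota 0 n) by rewrite has_find size_iota.
by have := nth_find 0 hp; rewrite nth_iota.
Qed.

Lemma bmin_spec n (p : pred nat) i : i < n -> p i ->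
  [/\ bmin n p < n, p (bmin n p) & bmin n p <= i].
Proof.
move=> lti pi; have le : bmin n p <= i.
  by rewrite leqNgt; apply/negP => /bmin_before; rewrite pi.
by have lt := leq_ltn_trans le lti; split=> //; exact: bmin_sat.
Qed.

Section BoundedSearch.
Variables (N : seq nat -> nat) (p : nat -> seq nat -> bool).
Hypotheses (rN : recursive (fun v => N (behead v)))
  (rp : recursive (fun v => p (nth 0 v 0) (behead v))).

(** Reaching the bound is added as a second way to stop, which makes unbounded minimisation
    total. *)
Lemma recursive_bmin : recursive (fun v => bmin (N v) (p^~ v)).
Proof.
apply: (@recursive_mu (fun i v => p i v || (N v <= i))) => [|v].
  apply: recursive_orb => //; apply: recursive_leq => //.
  exact: recursive_nth0.
split=> [|i lti].
  by have := bmin_le (N v) (p^~ v); rewrite leq_eqVlt => /orP[/eqP ->|/bmin_sat ->];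
    rewrite ?leqnn ?orbT.
rewrite negb_or (bmin_before lti) -ltnNge.
exact: leq_trans lti (bmin_le _ _).
Qed.
End BoundedSearch.

Lemma recursive_bex (N : seq nat -> nat) (p : nat -> seq nat -> bool) :
  recursive N -> recursive (fun v => N (behead v)) ->
  recursive (fun v => p (nth 0 v 0) (behead v)) ->
  recursive (fun v => bex (N v) (p^~ v)).
Proof.
move=> rN rN' rp.
apply: (@recursive_ext (fun v => bmin (N v) (p^~ v) < N v)) => [v|].
  by rewrite /bex has_find size_iota.
apply: recursive_leq rN; apply: recursive_succ; exact: recursive_bmin.
Qed.

Lemma recursive_ball (N : seq nat -> nat) (p : nat -> seq nat -> bool) :
  recursive N -> recursive (fun v => N (behead v)) ->
  recursive (fun v => p (nth 0 v 0) (behead v)) ->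
  recursive (fun v => ball (N v) (p^~ v)).
Proof.
move=> rN rN' rp.
apply: (@recursive_ext (fun v => ~~ bex (N v) (fun i => ~~ p i v))) => [v|].
  rewrite /bex /ball -all_predC; congr (nat_of_bool _).
  by apply: eq_all => i /=; rewrite negbK.
apply/recursive_negb/(recursive_bex (p := fun i v => ~~ p i v)) => //.
exact: recursive_negb.
Qed.

Create HintDb recdb discriminated.
#[local] Hint Constants Opaque : recdb.
#[local] Hint Resolve recursive_const recursive_nth0 recursive_nth1
  recursive_nth2 recursive_nth3 recursive_nth4 recursive_add recursive_sub recursive_mul
  recursive_exp recursive_andb recursive_orb recursive_implb recursive_negb
  recursive_leq recursive_eqn recursive_if recursive_succ recursive_pred
  recursive_bmin recursive_bex recursive_ball : recdb.
Ltac recursive := cbv zeta; solve [eauto 1000 with recdb nocore].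

(** * Coding of pairs and finite lists by numbers *)

(* [pairn] is injective but not onto. *)
Definition pairn a b := (a + b) * (a + b) + a.
(** The integer square root. It recovers [a + b] from [pairn a b], which is at least the square of
    [a + b] and below the next square. *)
Definition sqrtn n := bmin n (fun r => n < r.+1 * r.+1).
Definition fstn n := n - sqrtn n * sqrtn n.
Definition sndn n := sqrtn n - fstn n.
Arguments pairn : simpl never.
Arguments fstn : simpl never.
Arguments sndn : simpl never.

Lemma leq_pairn a b : a + b <= pairn a b.
Proof. by rewrite /pairn; case: (a + b) => // m; rewrite mulSn -addnA leq_addr. Qed.

Lemma sqrtn_pairn a b : sqrtn (pairn a b) = a + b.
Proof.
have lt : pairn a b < (a + b).+1 * (a + b).+1.
  by rewrite /pairn; lia.
have ge i : pairn a b < i.+1 * i.+1 -> a + b <= i.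
  by rewrite /pairn; have := @leq_mul i.+1 i.+1 (a + b) (a + b); lia.
apply/eqP; rewrite eqn_leq; apply/andP; split.
  rewrite leqNgt; apply/negP => /bmin_before.
  by rewrite lt.
rewrite /sqrtn; set p := fun r => _; have := bmin_le (pairn a b) p.
rewrite leq_eqVlt => /orP[/eqP ->|/bmin_sat/ge //]; exact: leq_pairn.
Qed.

Lemma fstn_pairn a b : fstn (pairn a b) = a.
Proof. by rewrite /fstn sqrtn_pairn addKn. Qed.

Lemma sndn_pairn a b : sndn (pairn a b) = b.
Proof. by rewrite /sndn fstn_pairn sqrtn_pairn addKn. Qed.

Lemma fstn_le n : fstn n <= n.
Proof. exact: leq_subr. Qed.

Lemma sndn_le n : sndn n <= n.
Proof. exact: leq_trans (leq_subr _ _) (bmin_le _ _). Qed.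

Lemma recursive_fstn F : recursive F -> recursive (fun v => fstn (F v)).
Proof. by apply: recursive_comp1; rewrite /recursive1 /fstn /sqrtn; recursive. Qed.
Lemma recursive_sndn F : recursive F -> recursive (fun v => sndn (F v)).
Proof. by apply: recursive_comp1; rewrite /recursive1 /sndn /fstn /sqrtn; recursive. Qed.
Lemma recursive_pairn F G :
  recursive F -> recursive G -> recursive (fun v => pairn (F v) (G v)).
Proof. by apply: recursive_comp2; rewrite /recursive2 /pairn; recursive. Qed.
#[local] Hint Resolve recursive_fstn recursive_sndn recursive_pairn : recdb.

(** [0] codes the empty list, and its head and tail are [0], in accord with missing arguments being
    read as 0. *)
Definition consn a v := (pairn a v).+1.
Definition headn v := fstn v.-1.
Definition tailn v := sndn v.-1.
Definition getn v i := headn (iter i tailn v).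
Definition encl (s : seq nat) := foldr consn 0 s.

Lemma recursive_headn F : recursive F -> recursive (fun v => headn (F v)).
Proof. by rewrite /headn; recursive. Qed.
Lemma recursive_tailn F : recursive F -> recursive (fun v => tailn (F v)).
Proof. by rewrite /tailn; recursive. Qed.
Lemma recursive_consn F G :
  recursive F -> recursive G -> recursive (fun v => consn (F v) (G v)).
Proof. by rewrite /consn; recursive. Qed.
#[local] Hint Resolve recursive_headn recursive_tailn recursive_consn : recdb.
Lemma recursive_getn F G :
  recursive F -> recursive G -> recursive (fun v => getn (F v) (G v)).
Proof.
move=> rF rG; rewrite /getn; apply: recursive_headn.
apply: (recursive_iter (g := fun=> tailn) (b := id)) => //.
- by rewrite /recursive2; recursive.
- by rewrite /recursive1; recursive.
Qed.
#[local] Hint Resolve recursive_getn : recdb.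

Lemma headn_cons a v : headn (consn a v) = a.
Proof. exact: fstn_pairn. Qed.
Lemma tailn_cons a v : tailn (consn a v) = v.
Proof. exact: sndn_pairn. Qed.
Lemma headn_encl s : headn (encl s) = nth 0 s 0.
Proof. by case: s => [|a s]; [|exact: headn_cons]. Qed.
Lemma tailn_encl s : tailn (encl s) = encl (behead s).
Proof. by case: s => [|a s]; [|exact: tailn_cons]. Qed.

Lemma getn_encl s i : getn (encl s) i = nth 0 s i.
Proof.
rewrite /getn; elim: i s => [|i IH] s; first exact: headn_encl.
by rewrite iterSr tailn_encl IH nth_behead.
Qed.

Lemma size_encl s : size s <= encl s.
Proof.
elim: s => //= a s IH; rewrite ltnS (leq_trans IH) //.
exact: leq_trans (leq_addl _ _) (leq_pairn _ _).
Qed.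

(** Taking the tail strictly decreases a positive code, so [v] tails lead to [0]. *)
Lemma getn_default v i : v <= i -> getn v i = 0.
Proof.
rewrite /getn => le; suff -> : iter i tailn v = 0 by [].
elim: i v le => [|i IH] v; first by rewrite leqn0 => /eqP.
rewrite iterSr => le; apply: IH; apply: leq_trans (sndn_le _) _.
by case: v le.
Qed.

(** * Arithmetisation of computations *)

(* Judgments [<c, v, y>] that the program numbered [c] on [v] outputs [y].
   Beside [code], program numbers comprise three auxiliary forms: [6] for "the
   values at [i :: v] are nonzero for all [i] below the head of the argument",
   and [7], [8] for lists of programs, whose output is the list of outputs.
   With these, every judgment follows from at most two others. *)
Definition node t a b := pairn t (pairn a b).
Fixpoint enc (c : code) : nat :=
  match c with
  | Zero => node 0 0 0
  | Succ => node 1 0 0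
  | Proj i => node 2 i 0
  | Comp f gs => node 3 (enc f) (foldr (fun g n => node 8 (enc g) n) (node 7 0 0) gs)
  | Prec f g => node 4 (enc f) (enc g)
  | Mu f => node 5 (enc f) 0
  end.
Definition encs := foldr (fun g n => node 8 (enc g) n) (node 7 0 0).

Definition judgment c v y := pairn c (pairn v y).
Definition output q := sndn (sndn q).

(** One disjunct per rule. An intermediate output is read off the premise itself, so that a rule is
    checked without quantifiers. *)
Definition inference q q1 q2 :=
  let c := fstn q in let v := fstn (sndn q) in let y := output q in
  let t := fstn c in let a := fstn (sndn c) in let b := sndn (sndn c) in
  let pv := consn (headn v).-1 (tailn v) in
  [|| (t == 0) && (y == 0),
      (t == 1) && (y == (headn v).+1),
      (t == 2) && (y == getn v a),
      [&& t == 3, q1 == judgment b v (output q1)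
        & q2 == judgment a (output q1) y],
      [&& t == 4, headn v == 0 & q1 == judgment a (tailn v) y],
      [&& t == 4, 0 < headn v, q1 == judgment c pv (output q1)
        & q2 == judgment b (consn (headn v).-1 (consn (output q1) (tailn v))) y],
      [&& t == 5, q1 == judgment a (consn y v) 0
        & q2 == judgment (node 6 a 0) (consn y v) 0],
      (t == 6) && (headn v == 0),
      [&& t == 6, q1 == judgment c pv 0, q2 == judgment a pv (output q2)
        & 0 < output q2],
      (t == 7) && (y == 0)
    | [&& t == 8, q1 == judgment a v (output q1), q2 == judgment b v (output q2)
        & y == consn (output q1) (output q2)]].

Lemma recursive_inference F G H : recursive F -> recursive G -> recursive H ->
  recursive (fun v => inference (F v) (G v) (H v)).
Proof.
apply: (recursive_comp3 (g := fun q q1 q2 => inference q q1 q2)).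
by rewrite /recursive3 /inference /judgment /output /node; recursive.
Qed.
#[local] Hint Resolve recursive_inference : recdb.

Definition derivation L := ball L (fun i =>
  bex L (fun j1 => bex L (fun j2 =>
    inference (getn L i) (getn L (i.+1 + j1)) (getn L (i.+1 + j2))))).

(* [t] pairs an output with a list of judgments, each one inferred from later
   ones or from the default [0], which is the judgment on [Zero]. *)
Definition halts e x t :=
  derivation (sndn t) &&
  (getn (sndn t) 0 == judgment e (consn x 0) (fstn t)).

Lemma recursive_halts F G H : recursive F -> recursive G -> recursive H ->
  recursive (fun v => halts (F v) (G v) (H v)).
Proof.
apply: (recursive_comp3 (g := fun e x t => halts e x t)).
by rewrite /recursive3 /halts /derivation /judgment; recursive.
Qed.
#[local] Hint Resolve recursive_halts : recdb.

(** One clause for each kind of program number; a judgment on any other number satisfies all three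
    vacuously. *)
Definition sound q :=
  [/\ forall c v y, q = judgment (enc c) (encl v) y -> eval c v y,
      forall f v y, q = judgment (node 6 (enc f) 0) (encl v) y ->
        forall i, i < nth 0 v 0 -> exists z, eval f (i :: behead v) z.+1
    & forall gs v y, q = judgment (encs gs) (encl v) y ->
        exists ws, y = encl ws /\ evals gs v ws].

Lemma judgmentE c v y :
  (fstn (judgment c v y) = c) * (fstn (sndn (judgment c v y)) = v) *
  (output (judgment c v y) = y).
Proof. by rewrite /output /judgment !fstn_pairn !sndn_pairn fstn_pairn. Qed.

Lemma nodeE t a b :
  (fstn (node t a b) = t) * (fstn (sndn (node t a b)) = a) *
  (sndn (sndn (node t a b)) = b).
Proof. by rewrite /node !fstn_pairn !sndn_pairn fstn_pairn. Qed.

Lemma inference_sound q q1 q2 :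
  inference q q1 q2 -> sound q1 -> sound q2 -> sound q.
Proof.
move=> infq [ev1 nz1 evs1] [ev2 nz2 evs2]; split.
- move=> c v y Eq; move: infq; rewrite Eq /inference !judgmentE.
  case: c Eq => [||i|f gs|f g|f] Eq; rewrite /enc -/enc !nodeE /= ?orbF.
  + by move/eqP.
  + by rewrite headn_encl => /eqP.
  + by rewrite getn_encl => /eqP.
  + move=> /andP[/eqP /evs1 [ws [-> gsws]] /eqP /ev2 fy].
    by apply/eval_Comp; exists ws.
  + rewrite headn_encl tailn_encl => /orP[/andP[/eqP E /eqP /ev1]|].
      by rewrite E.
    case: (nth 0 v 0) => // m /and3P[_ /eqP E1 /eqP E2] /=.
    exists (output q1); split; last by apply: ev2; rewrite E2.
    by have := ev1 (Prec f g) (m :: behead v) (output q1); rewrite /= -/enc -E1; exact.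
  + move=> /andP[/eqP E1 /eqP E2]; split; first by apply: ev1; rewrite E1.
    by move=> i lti; have := nz2 f (y :: v) 0 E2 i; exact.
- move=> f v y Eq; move: infq; rewrite Eq /inference !judgmentE !nodeE /= ?orbF.
  rewrite headn_encl tailn_encl => /orP[/eqP -> //|].
  move=> /and3P[/eqP E1 /eqP E2 gt0] i.
  case: (nth 0 v 0) E1 E2 => // m E1 E2.
  rewrite ltnS leq_eqVlt => /orP[/eqP ->|lti].
    exists (output q2).-1; rewrite prednK //.
    exact: ev2.
  by have := nz1 f (m :: behead v) 0 E1 i; exact.
- move=> [|g gs] v y Eq; move: infq; rewrite Eq /inference !judgmentE /encs /= -/encs ?nodeE /= ?orbF.
    by move/eqP ->; exists [::].
  move=> /and3P[/eqP/ev1 gv /eqP/evs2[ws [-> gsws]] /eqP ->].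
  by exists (output q1 :: ws).
Qed.

Lemma sound0 : sound 0.
Proof.
have tag c v y : 0 = judgment c v y -> fstn c = 0.
  by move/(congr1 (fun q => fstn (fstn q))); rewrite judgmentE.
have tagE t a b : fstn (node t a b) = 0 -> t = 0 by rewrite nodeE.
split=> [c v y E|f v y /tag/tagE //|gs v y /tag].
  have Ey : y = 0 by have := congr1 output E; rewrite judgmentE.
  by move/tag: E; case: c => [||i|f gs|f g|f] //= /tagE.
by case: gs => [|g gs] /tagE.
Qed.

(** Premises stand at later positions, and positions from [L] on read as the sound judgment [0]; so
    [L - i] decreases. *)
Lemma derivation_sound i L : derivation L -> sound (getn L i).
Proof.
move=> /ballP der; have [n] := ubnP (L - i); elim: n i => // n IH i lt.
have [/getn_default ->|ltL] := leqP L i; first exact: sound0.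
have /bexP[j1 _ /bexP[j2 _]] := der i ltL.
by move/inference_sound; apply; apply: IH; lia.
Qed.

Lemma halts_sound c x t : halts (enc c) x t -> eval c [:: x] (fstn t).
Proof.
by move=> /andP[/(derivation_sound 0)[ev _ _] /eqP E]; exact: ev.
Qed.

(** Derivations whose premises are found by membership instead of position, so that concatenation
    preserves them. *)
Fixpoint derives s :=
  if s is q :: s' then
    has (fun q1 => has (fun q2 => inference q q1 q2) (0 :: s')) (0 :: s')
    && derives s'
  else true.

Definition derivable q := exists s, derives (q :: s).

Lemma has_sub (s s' : seq nat) (p p' : pred nat) : {subset s <= s'} ->
  subpred p p' -> has p s -> has p' s'.
Proof.
by move=> ss pp /hasP[x xs px]; apply/hasP; exists x; [exact: ss|exact: pp].
Qed.

Lemma derives_cat s s' : derives s -> derives s' -> derives (s ++ s').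
Proof.
elim: s => //= q s IH /andP[Hq /IH ds] /ds ->; rewrite andbT.
have sub : {subset 0 :: s <= 0 :: (s ++ s')}.
  by move=> x; rewrite !inE mem_cat => /orP[->|->]; rewrite ?orbT.
move: Hq; apply: (@has_sub (0 :: s) (0 :: (s ++ s'))) => // q1.
exact: (@has_sub (0 :: s) (0 :: (s ++ s'))).
Qed.

Lemma derivable_inference q q1 q2 :
  inference q q1 q2 -> derivable q1 -> derivable q2 -> derivable q.
Proof.
move=> infq [s1 d1] [s2 d2]; exists ((q1 :: s1) ++ (q2 :: s2)).
have d12 := derives_cat d1 d2.
rewrite /derives -/derives d12 andbT.
apply/hasP; exists q1; first by rewrite !inE eqxx orbT.
by apply/hasP; exists q2; rewrite // inE mem_cat mem_head !orbT.
Qed.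

Lemma derivable0 : derivable 0.
Proof. by exists [::]. Qed.

Lemma derives_derivation s : derives s -> derivation (encl s).
Proof.
move=> ds; apply/ballP => i lti.
suff [j1 [j2 [l1 l2 inf]]] : exists j1 j2,
    [/\ j1 < encl s, j2 < encl s & inference (nth 0 s i) (nth 0 s (i.+1 + j1))
                              (nth 0 s (i.+1 + j2))].
  by apply/bexP; exists j1 => //; apply/bexP; exists j2; rewrite ?getn_encl.
(* The default judgment [0] is read one place past the end, at position [size s']. *)
have pos q s' : q \in 0 :: s' -> exists2 j, j < (size s').+1 & q = nth 0 s' j.
  rewrite inE => /orP[/eqP ->|]; first by exists (size s'); rewrite ?nth_default.
  by move=> /(nthP 0)[j ltj <-]; exists j; rewrite // ltnW.
have [le|lts] := leqP (size s) i.
  (* Past the end all three entries are [0], which follows from itself by the rule for [Zero]. *)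
  by exists 0, 0; split; rewrite ?nth_default //; lia.
move: (size_encl s) => lesz.
suff [j1 [j2 [l1 l2 inf]]] : exists j1 j2,
    [/\ j1 + i < size s, j2 + i < size s & inference (nth 0 s i)
      (nth 0 s (i.+1 + j1)) (nth 0 s (i.+1 + j2))].
  by exists j1, j2; split=> //; lia.
elim: s i ds lts {lti lesz} => // q s IH [|i] /= /andP[Hq ds].
  move: Hq => /(@hasP _ _ (0 :: s))[q1 /pos[j1 l1 ->]] /(@hasP _ _ (0 :: s))[q2 /pos[j2 l2 ->]].
  by exists j1, j2; rewrite !addn0.
move=> /(IH i ds) [j1 [j2 [l1 l2 inf]]].
by exists j1, j2; split; rewrite ?addnS ?addSn.
Qed.

(** The induction hypothesis has to reach the programs in the list under [Comp]. *)
Lemma code_nested_ind (P : code -> Prop) :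
  P Zero -> P Succ -> (forall i, P (Proj i)) ->
  (forall f gs, P f -> foldr (fun g Q => P g /\ Q) True gs -> P (Comp f gs)) ->
  (forall f g, P f -> P g -> P (Prec f g)) ->
  (forall f, P f -> P (Mu f)) -> forall c, P c.
Proof.
move=> P0 PS Pp PC PP PM; fix IH 1 => -[||i|f gs|f g|f].
- exact: P0.
- exact: PS.
- exact: Pp.
- by apply: PC => //; elim: gs => [|g gs IHgs].
- exact: PP.
- exact: PM.
Qed.

Lemma eval_derivable c v y :
  eval c v y -> derivable (judgment (enc c) (encl v) y).
Proof.
have d0 := derivable0.
elim/code_nested_ind: c v y => [||i|f gs IHf IHgs|f g IHf IHg|f IHf] v y.
- move=> ->; apply: (@derivable_inference _ 0 0) => //.
  by rewrite /inference !judgmentE !nodeE.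
- move=> ->; apply: (@derivable_inference _ 0 0) => //.
  by rewrite /inference !judgmentE !nodeE /= headn_encl eqxx.
- move=> ->; apply: (@derivable_inference _ 0 0) => //.
  by rewrite /inference !judgmentE !nodeE /= getn_encl eqxx.
- move=> /eval_Comp[ws [gsws /IHf d2]].
  have d1 : derivable (judgment (encs gs) (encl v) (encl ws)).
    elim: gs ws IHgs gsws {d2} => [|g gs IH] [|w ws] //=.
      move=> _ _; apply: (@derivable_inference _ 0 0) => //.
      by rewrite /inference !judgmentE !nodeE.
    move=> [IHg IHgs] [/IHg d1 /(IH _ IHgs) d2].
    apply: (derivable_inference _ d1 d2).
    by rewrite /inference !judgmentE !nodeE /= !eqxx.
  apply: (derivable_inference _ d1 d2).
  by rewrite /inference !judgmentE !nodeE /= !eqxx.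
- have tE : headn (encl v) = nth 0 v 0 by exact: headn_encl.
  (* The coded argument list is generalised to any number with the given head and tail, as the
     recursion changes only the head. *)
  move=> /=; move: tE; have := tailn_encl v; move: (encl v) (behead v).
  elim: (nth 0 v 0) y => [|m IH] y e w tE hE.
    move=> /IHf d1; apply: (derivable_inference _ d1 d0).
    by rewrite /inference !judgmentE !nodeE /= hE tE !eqxx ?orbT.
  move=> [z [+ /IHg d2]].
  move/(IH z (consn m (encl w)) w); rewrite tailn_cons headn_cons.
  move=> /(_ erefl erefl) d1; apply: (derivable_inference _ d1 d2).
  by rewrite /inference !judgmentE !nodeE /= hE tE !eqxx ?orbT.
- move=> [/IHf d1 pos]; apply: (derivable_inference (q2 :=
    judgment (node 6 (enc f) 0) (encl (y :: v)) 0) _ d1) => /=.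
    by rewrite /inference !judgmentE !nodeE /= !eqxx.
  (* The auxiliary judgment of tag 6 is derived one value of [f] at a time. *)
  elim: y pos {d1} => [|y IH] pos.
    apply: (@derivable_inference _ 0 0) => //.
    by rewrite /inference !judgmentE !nodeE /= headn_cons.
  have [z /IHf d2] := pos y (leqnn _).
  have d1 := IH (fun i lti => pos i (ltnW lti)).
  apply: (derivable_inference _ d1 d2).
  by rewrite /inference !judgmentE !nodeE /= headn_cons tailn_cons /= !eqxx ?orbT.
Qed.

Lemma halts_complete c x y :
  eval c [:: x] y -> exists2 t, halts (enc c) x t & fstn t = y.
Proof.
move=> /eval_derivable[s ds]; set q := judgment _ _ _ in ds.
exists (pairn y (encl (q :: s))); last exact: fstn_pairn.
by rewrite /halts fstn_pairn sndn_pairn derives_derivation // getn_encl eqxx.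
Qed.

(** * Canonical indices, computable functions and c.e. sets *)

Local Open Scope classical_set_scope.

Definition digit u x := odd (u %/ 2 ^ x).

(** The digit of [u] at [x] is 1 iff, for some [h], [u] is at least [(2h + 1) * 2 ^ x] and below
    [(2h + 2) * 2 ^ x]; this expresses it without division. *)
Lemma recursive_digit F G :
  recursive F -> recursive G -> recursive (fun v => digit (F v) (G v)).
Proof.
apply: (recursive_comp2 (g := fun u x => digit u x)).
apply: (@recursive_ext (fun v => let u := nth 0 v 0 in let d := 2 ^ nth 0 v 1 in
  bex u.+1 (fun h => ((h + h).+1 * d <= u) && (u < (h + h).+2 * d)))); last first.
  by recursive.
move=> v /=; set u := nth 0 v 0; set x := nth 0 v 1.
have gt0 : 0 < 2 ^ x by rewrite expn_gt0.
rewrite /digit; congr (nat_of_bool _); apply/bexP/idP => [[h _ /andP[le lt]]|oddq].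
  have -> : u %/ 2 ^ x = (h + h).+1.
    by apply/eqP; rewrite eqn_leq -ltnS ltn_divLR // lt leq_divRL.
  by rewrite /= oddD addbb.
have Eq : (u %/ 2 ^ x)./2 + (u %/ 2 ^ x)./2 = (u %/ 2 ^ x).-1.
  by rewrite addnn -[in RHS](odd_double_half (u %/ 2 ^ x)) oddq.
have q0 : 0 < u %/ 2 ^ x by case: (u %/ 2 ^ x) oddq.
exists (u %/ 2 ^ x)./2.
  by have := leq_div u (2 ^ x); lia.
by rewrite Eq prednK // leq_divM ltn_ceil.
Qed.
#[local] Hint Resolve recursive_digit : recdb.

Lemma D0 x : ~ D 0 x.
Proof. by rewrite /D /= div0n. Qed.

Lemma D_exp2 y x : D (2 ^ y) x <-> x = y.
Proof.
rewrite /D /=; split=> [|->]; last by rewrite divnn expn_gt0.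
have [le|lt] := leqP x y; last by rewrite divn_small // ltn_exp2l.
rewrite -expnB // oddX orbF subn_eq0 => leyx.
by apply/eqP; rewrite eqn_leq le.
Qed.

Lemma D_lt u x : D u x -> x < u.
Proof.
rewrite /D /= => oddq; apply: leq_trans (ltn_expl x (ltnSn 1)) _.
by rewrite leqNgt; apply/negP => lt; move: oddq; rewrite divn_small.
Qed.

(** The given code is specified on one-element lists only; composing it with [Proj 0] cuts longer
    lists down. *)
Lemma computable_recursive f F :
  computable_fun f -> recursive F -> recursive (fun v => f (F v)).
Proof.
move=> [c cP]; apply: recursive_comp1; exists (Comp c [:: Proj 0]) => v y.
rewrite eval_Comp; split=> [[[|w [|w' ws]] [//=]]|->].
- by move=> [-> _] /cP.
- by case.
- by exists [:: nth 0 v 0]; split=> //; apply/cP.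
Qed.

Lemma recursive_computable f : recursive1 f -> computable_fun f.
Proof. by move=> [c cP]; exists c => x y; rewrite cP; split=> ->. Qed.

Lemma ce_exists (p : nat -> nat -> bool) :
  recursive2 p -> ce_set [set x | exists s, p s x].
Proof.
move=> rp; have [|c cP] := @eval_Mu (fun s v => p s (nth 0 v 0)).
  by apply: (recursive_comp2 rp); recursive.
exists c => x; split=> [[s psx]|[s /cP[psx _]]]; last by exists s.
have ex : exists s, p s x by exists s.
exists (ex_minn ex); apply/cP; case: ex_minnP => m pm mmin; split=> // i lti.
by apply/negP => /mmin; rewrite leqNgt lti.
Qed.

(** * Movable markers and the c.e. set [Y] *)

(* The bound [(s + u).+2] is never reached: [(s + u).+1] passes the test. *)
Definition next s u := bmin (s + u).+2 (fun w => (u < w) &&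
  ball u.+1 (fun e => ball s.+1 (fun t =>
    halts e u t ==> bex w (fun t' => halts e u t')))).

(** The approximation at stage [s] to the limit position [y_k]. *)
Definition marker s k := iter k (next s) 0.

Lemma recursive_next F G :
  recursive F -> recursive G -> recursive (fun v => next (F v) (G v)).
Proof. by apply: recursive_comp2; rewrite /recursive2 /next; recursive. Qed.
#[local] Hint Resolve recursive_next : recdb.

Lemma recursive_marker F G :
  recursive F -> recursive G -> recursive (fun v => marker (F v) (G v)).
Proof.
move=> rF rG; apply: (recursive_iter (b := fun=> 0)) => //.
- by rewrite /recursive2; recursive.
- by rewrite /recursive1; recursive.
Qed.
#[local] Hint Resolve recursive_marker : recdb.

Definition settled s u w :=
  forall e t, e <= u -> t <= s -> halts e u t -> exists2 t', t' < w & halts e u t'.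

Lemma nextP s u : [/\ u < next s u, settled s u (next s u)
  & forall w, u < w -> settled s u w -> next s u <= w].
Proof.
rewrite /next; set p := (p in bmin _ p).
have pP w : reflect (u < w /\ settled s u w) (p w).
  apply: (iffP andP) => -[ltw H]; split=> //.
    move=> e t le_e le_t h; move/ballP: H => /(_ e le_e)/ballP/(_ t le_t).
    by move/implyP/(_ h)/bexP.
  apply/ballP => e le_e; apply/ballP => t le_t; apply/implyP => h.
  by apply/bexP; exact: H h.
have ps : p (s + u).+1.
  by apply/pP; split=> [|e t _ le_t h]; [lia|exists t => //; lia].
have [lt /pP[gt st] le] := bmin_spec (ltnSn _) ps; split=> // w ltw stw.
have [lew|] := leqP w (s + u).+1; last by lia.
by have [] := @bmin_spec (s + u).+2 p w lew (introT (pP w) (conj ltw stw)).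
Qed.

Lemma next_gt s u : u < next s u. Proof. by case: (nextP s u). Qed.

(** The witnesses that settle stage [s'] lie below [next s' u], hence are at most [s] and already
    seen at stage [s]. *)
Lemma next_stable s s' u : s <= s' -> next s' u <= s.+1 -> next s u = next s' u.
Proof.
move=> les le; have [gt st mn] := nextP s u; have [gt' st' mn'] := nextP s' u.
apply/eqP; rewrite eqn_leq; apply/andP; split.
  by apply: mn => // e t le_e le_t; apply: st' => //; exact: leq_trans les.
apply: mn' => // e t le_e le_t /(st' e t le_e le_t)[t' ltt' h'].
by apply: (st e t') h' => //; lia.
Qed.

Lemma marker_lt s : {homo marker s : k k' / k < k'}.
Proof. by apply: (homo_ltn ltn_trans) => k; exact: next_gt. Qed.

Lemma marker_inj s : injective (marker s).
Proof.
move=> k k' E; case: (ltngtP k k') => // /(marker_lt s); rewrite E ltnn //.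
Qed.

Lemma marker_ge s k : k <= marker s k.
Proof. by elim: k => // k IH; exact: leq_ltn_trans IH (next_gt _ _). Qed.

(** Positions increase with the index, so all markers up to [k] lie within [s] and [next_stable]
    applies to each. *)
Lemma marker_stable s s' k : s <= s' -> marker s' k <= s ->
  marker s k = marker s' k.
Proof.
move=> les; elim: k => // k IH le; rewrite /= -/(marker s k) -/(marker s' k).
rewrite IH; last exact: leq_trans (ltnW (next_gt _ _)) le.
by apply: next_stable => //; exact: leqW.
Qed.

(** A marker on [y] at a stage after [s >= y] was there at stage [s] already, so a dropped number
    stays dropped. Only [k <= y] can matter, since [k <= marker s k]. *)
Definition dropped s y := (y <= s) && ~~ bex y.+1 (fun k => marker s k == y).
Definition Y : set nat := [set y | exists s, dropped s y].

(** If some marker is on [y] at every stage from [y] on, stability makes it the one found at stage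
    [y]. *)
Lemma not_YP y : ~ Y y <-> exists k, forall s, y <= s -> marker s k = y.
Proof.
split=> [nYy|[k kP] [s /andP[les /bexP[]]]]; last first.
  by exists k; [rewrite ltnS -[leqRHS](kP s les); exact: marker_ge|rewrite kP].
have ex s : y <= s -> exists k, marker s k = y.
  move=> les; have : ~~ dropped s y by apply/negP => ?; apply: nYy; exists s.
  by rewrite /dropped les negbK => /bexP[k _ /eqP]; exists k.
have [k Ek] := ex y (leqnn y); exists k => s les; have [k' Ek'] := ex s les.
have /(marker_inj) <- // : marker y k' = marker y k.
by rewrite Ek -Ek'; apply: marker_stable; rewrite Ek'.
Qed.

(** Induction on [k]: once marker [k] rests at [u], the next one rests as soon as the stage bounds a
    witness for each of the finitely many [e <= u] that halt on [u]. *)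
Lemma marker_limit k : exists2 y, ~ Y y & forall s, y <= s -> marker s k = y.
Proof.
suff [y [s0 lim]] : exists y s0, forall s, s0 <= s -> marker s k = y.
  (* Stability carries the limit position [y] back from late stages to every stage from [y] on. *)
  have lim' s : y <= s -> marker s k = y.
    move=> les; rewrite -[RHS](lim (maxn s s0)) ?leq_maxr //.
    by apply: marker_stable; rewrite ?leq_maxl // lim ?leq_maxr.
  by exists y => //; apply/not_YP; exists k.
elim: k => [|k [u [s0 lim]]]; first by exists 0, 0.
have [N NP] : exists N, forall e t, e <= u -> halts e u t ->
    exists2 t', t' <= N & halts e u t'.
  have bnd n : exists N, forall e t, e < n -> halts e u t ->
      exists2 t', t' <= N & halts e u t'.
    elim: n => [|n [N NP]]; first by exists 0.
    have [[t0 h0]|nh] := pselect (exists t, halts n u t).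
      exists (maxn N t0) => e t; rewrite ltnS leq_eqVlt => /orP[/eqP -> _|lte].
        by exists t0; rewrite ?leq_maxr.
      by move=> /(NP e t lte)[t' le' h']; exists t' => //; rewrite leq_max le'.
    exists N => e t; rewrite ltnS leq_eqVlt => /orP[/eqP -> h|]; last exact: NP.
    by case: nh; exists t.
  by have [N NP] := bnd u.+1; exists N => e t; exact: NP.
exists (next N u), (maxn s0 N) => s; rewrite geq_max => /andP[les0 leN].
rewrite /= -/(marker s k) lim //.
have [gt st mn] := nextP N u; have [gt' st' mn'] := nextP s u.
apply/eqP; rewrite eqn_leq; apply/andP; split.
  apply: mn' => // e t le_e _ /(NP e t le_e)[t' le' h']; exact: st h'.
by apply: mn => // e t le_e le_t; apply: st' => //; exact: leq_trans leN.
Qed.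

(** At a late stage [y] and [y'] carry markers [k < k'], so [y'] is at least [next s y], which lies
    beyond a witness. *)
Lemma not_Y_settled e y y' t : ~ Y y -> ~ Y y' -> y < y' -> e <= y ->
  halts e y t -> exists2 t', t' < y' & halts e y t'.
Proof.
move=> /not_YP[k kP] /not_YP[k' kP'] lt le_e h.
pose s := maxn y' t; have les : y' <= s by exact: leq_maxl.
have Ek := kP s (leq_trans (ltnW lt) les); have Ek' := kP' s les.
have ltk : k < k'.
  rewrite ltnNge; apply/negP; rewrite leq_eqVlt => /orP[/eqP E|/(marker_lt s)].
    by move: lt; rewrite -Ek -Ek' E ltnn.
  by rewrite Ek Ek' ltnNge (ltnW lt).
have [_ st _] := nextP s y.
have [t' lt' h'] := st e t le_e (leq_maxr _ _) h; exists t' => //.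
apply: leq_trans lt' _; have -> : next s y = marker s k.+1 by rewrite -Ek.
rewrite -Ek'; move: ltk; rewrite leq_eqVlt => /orP[/eqP -> //|].
by move/(marker_lt s)/ltnW.
Qed.

(** [e] searches for the least [w] with [q w y]; a halting witness pairs this output with a
    derivation and so bounds it. *)
Lemma not_Y_dominates (q : nat -> nat -> bool) : recursive2 q ->
  exists e, forall y y' w, ~ Y y -> ~ Y y' -> e <= y -> y < y' -> q w y ->
    exists2 w', w' < y' & q w' y.
Proof.
move=> rq; have [|c cP] := @eval_Mu (fun w v => q w (nth 0 v 0)).
  by apply: (recursive_comp2 rq); recursive.
exists (enc c) => y y' w nY nY' le_e lt qwy.
have ex : exists w, q w y by exists w.
have : eval c [:: y] (ex_minn ex).
  apply/cP; case: ex_minnP => m qm mmin; split=> // i lti.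
  by apply/negP => /mmin; rewrite leqNgt lti.
case/halts_complete => t h _.
have [t' lt' /halts_sound/cP[qt _]] := not_Y_settled nY nY' lt le_e h.
by exists (fstn t') => //; exact: leq_ltn_trans (fstn_le _) lt'.
Qed.

(** * The set [X] and its reduction to [Y] *)

(** W consists of the [y] for which this holds at some [s]. The second component of [k] is free, so
    every program is tested by markers arbitrarily far out. *)
Definition enters y s := (y <= s) && bex y.+1 (fun k => (marker s k == y) &&
  bex s.+1 (fun t => halts (fstn k) y t && (fstn t == 0))).

Definition first_enters y s := enters y s && ball s (fun i => ~~ enters y i).

(** As [pairn] is not onto, the equality test discards the numbers that are not pairs; this keeps
    [x] unique for each [y]. *)
Definition code_of x := if first_enters (fstn x) (sndn x) &&
  (x == pairn (fstn x) (sndn x)) then 2 ^ fstn x else 0.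

Definition X : set nat := [set x | D (code_of x) `<=` Y].

Lemma recursive_dropped F G :
  recursive F -> recursive G -> recursive (fun v => dropped (F v) (G v)).
Proof.
apply: (recursive_comp2 (g := fun s y => dropped s y)).
by rewrite /recursive2 /dropped; recursive.
Qed.
Lemma recursive_code_of F : recursive F -> recursive (fun v => code_of (F v)).
Proof.
apply: recursive_comp1.
by rewrite /recursive1 /code_of /first_enters /enters; recursive.
Qed.
#[local] Hint Resolve recursive_dropped recursive_code_of : recdb.

Lemma code_of_inj x x' y : code_of x = 2 ^ y -> code_of x' = 2 ^ y -> x = x'.
Proof.
have fE z : code_of z = 2 ^ y ->
    [/\ fstn z = y, first_enters y (sndn z) & z = pairn y (sndn z)].
  rewrite /code_of; case: ifP => [/andP[fe /eqP E] /eqP|_ /esym/eqP]; last first.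
    by rewrite expn_eq0.
  by rewrite eqn_exp2l // => /eqP Ey; rewrite -Ey.
move=> /fE[_ /andP[h /ballP m] ->] /fE[_ /andP[h' /ballP m'] ->].
congr pairn; case: (ltngtP (sndn x) (sndn x')) => // [/m'|/m]; rewrite ?h ?h' //.
Qed.

Lemma code_of_le x y : code_of x = 2 ^ y -> y <= x.
Proof.
rewrite /code_of; case: ifP => [_ /eqP|_ /esym/eqP]; last by rewrite expn_eq0.
by rewrite eqn_exp2l // => /eqP <-; exact: fstn_le.
Qed.

Lemma enters_code y s : enters y s -> exists x, code_of x = 2 ^ y.
Proof.
move=> ent; have ex : exists s, enters y s by exists s.
case: (ex_minnP ex) => m em mmin; exists (pairn y m).
rewrite /code_of !fstn_pairn !sndn_pairn eqxx andbT /first_enters em /=.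
case: ballP => // -[] i lti; apply/negP => /mmin; by rewrite leqNgt lti.
Qed.

Lemma code_enters x y : code_of x = 2 ^ y -> exists s, enters y s.
Proof.
rewrite /code_of; case: ifP => [/andP[/andP[h _] _] /eqP|_ /esym/eqP]; last first.
  by rewrite expn_eq0.
by rewrite eqn_exp2l // => /eqP <-; exists (sndn x).
Qed.

Lemma code_ofP x : code_of x = 0 \/ exists y, code_of x = 2 ^ y.
Proof. by rewrite /code_of; case: ifP => _; [right; exists (fstn x)|left]. Qed.

Lemma ce_Y : ce_set Y.
Proof. by apply: ce_exists; rewrite /recursive2; recursive. Qed.

Lemma ce_X : ce_set X.
Proof.
suff -> : X = [set x | exists s, (code_of x == 0) || dropped s (fstn x)].
  apply: (@ce_exists (fun s x => (code_of x == 0) || dropped s (fstn x))).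
  by rewrite /recursive2; recursive.
apply/seteqP; split=> x; rewrite /X /=.
  rewrite {1}/code_of; case: ifP => [_ /(_ (fstn x))|E _].
    by case=> [|s ds]; [exact/D_exp2|exists s; rewrite ds orbT].
  by exists 0; rewrite /code_of E.
case=> s /orP[/eqP -> z /D0 //|ds] z; rewrite /code_of; case: ifP => _.
  by move/D_exp2 ->; exists s.
by move/D0.
Qed.

Lemma c1_X_Y : le_c1 X Y.
Proof.
exists code_of; split; first split=> //.
  by apply: recursive_computable; rewrite /recursive1; recursive.
move=> x x' ne; apply/seteqP; split=> // z [].
case: (code_ofP x) => [-> /D0 //|[y E]]; rewrite E => /D_exp2 ->.
case: (code_ofP x') => [-> /D0 //|[y' E']]; rewrite E' => /D_exp2 Ey.
by apply: ne; apply: (@code_of_inj _ _ y) => //; rewrite E' Ey.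
Qed.

(** * No c1-reduction from [X] to [Y] has computable range *)

Section Reduction.
Variable f : nat -> nat.
Hypothesis c1f : c1_reduction X Y f.

Lemma c1_disjoint x x' z : D (f x) z -> D (f x') z -> x = x'.
Proof.
move=> Dx Dx'; have [//|/eqP ne] := eqVneq x x'.
have : (D (f x) `&` D (f x')) z by [].
by have [_ ->] := c1f.
Qed.

(** By disjointness each [z < e] has at most one owner. *)
Lemma c1_bounded e : exists N, forall x z, z < e -> D (f x) z -> x <= N.
Proof.
elim: e => [|e [N NP]]; first by exists 0.
have [[x0 D0]|nD] := pselect (exists x, D (f x) e).
  exists (maxn N x0) => x z; rewrite ltnS leq_eqVlt => /orP[/eqP ->|ltz] Dz.
    by rewrite (c1_disjoint Dz D0) leq_maxr.
  by rewrite leq_max (NP x z).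
exists N => x z; rewrite ltnS leq_eqVlt => /orP[/eqP -> Dz|]; last exact: NP.
by case: nD; exists x.
Qed.

Lemma c1_self_covering : exists N, forall x y,
  N < y -> ~ Y y -> code_of x = 2 ^ y -> D (f x) y.
Proof.
have [[cf XY] _] := c1f; have := computable_recursive cf => rf.
(* This search finds the owner of [z]. If [z < y], domination puts it below [y], but the owner [x]
   is at least [y]. *)
have [|e1 dom1] := @not_Y_dominates (fun w z => digit (f w) z).
  by rewrite /recursive2; apply: recursive_digit; [apply: rf|]; recursive.
(* This search yields from [y] a bound on [f x], which exceeds [z]. If [y < z], domination puts the
   bound below [z]. *)
have [|e2 dom2] := @not_Y_dominates (fun w y =>
    bex w.+1 (fun x => (code_of x == 2 ^ y) && (f x <= w))).
  by rewrite /recursive2; move: rf; recursive.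
(* Since [N < y <= x], no element of [D (f x)] is below [e1]. *)
have [N NP] := c1_bounded e1.
exists (maxn N e2) => x y; rewrite gtn_max => /andP[ltN lt2] nYy Ex.
have [z Dz nYz] : exists2 z, D (f x) z & ~ Y z.
  have nXx : ~ X x by move=> /(_ y); rewrite Ex => H; apply/nYy/H/D_exp2.
  apply: contrapT => nz; apply: nXx; apply/XY => z Dz.
  by apply: contrapT => nYz; apply: nz; exists z.
have le1 : e1 <= z.
  rewrite leqNgt; apply/negP => /NP/(_ Dz); rewrite leqNgt.
  by rewrite (leq_trans ltN) // code_of_le.
case: (ltngtP z y) => [ltzy|ltyz|<- //].
  have [w ltw Dw] := dom1 z y x nYz nYy le1 ltzy Dz.
  by have := code_of_le Ex; rewrite (c1_disjoint Dz Dw) leqNgt ltw.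
have qy : bex (maxn x (f x)).+1
    (fun x' => (code_of x' == 2 ^ y) && (f x' <= maxn x (f x))).
  by apply/bexP; exists x; rewrite ?ltnS ?leq_maxl // Ex eqxx leq_maxr.
have [w ltw /bexP[x' _ /andP[/eqP Ex' lef]]] :=
  dom2 y z _ nYy nYz (ltnW lt2) ltyz qy.
have := D_lt Dz; rewrite (code_of_inj Ex Ex') ltnNge.
by rewrite (leq_trans lef) // ltnW.
Qed.

Lemma c1_noncomputable_range : ~ computable_set (\bigcup_x D (f x)).
Proof.
case=> chi [cchi chiP].
have [N cover] := c1_self_covering.
have rf := computable_recursive (proj1 (proj1 c1f)).
have rchi := computable_recursive cchi.
(* The second disjunct ends the search at once when [z] is outside the range. *)
have ex z : exists x, digit (f x) z || ~~ chi z.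
  have [/chiP[x _ Dz]|nchi] := boolP (chi z); last by exists 0; rewrite orbT.
  by exists x; apply/orP; left.
pose owner z := ex_minn (ex z).
have ownerP x z : D (f x) z -> owner z = x.
  move=> Dz; rewrite /owner; case: ex_minnP => x' + _.
  have -> : chi z by apply/chiP; exists x.
  by rewrite orbF => Dz'; exact: c1_disjoint Dz' Dz.
have rowner : recursive1 owner.
  apply: (@recursive_mu (fun x v => digit (f x) (nth 0 v 0) || ~~ chi (nth 0 v 0))).
    by move: rf rchi; recursive.
  move=> v; rewrite /owner; case: ex_minnP => x hx xmin; split=> // i lti.
  by apply/negP => /xmin; rewrite leqNgt lti.
(* The first conjunct excludes the [z] outside the range, where [owner z] is a mere default. *)
pose b z := digit (f (owner z)) z && (code_of (owner z) == 2 ^ z).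
have [c cP] : computable_fun b.
  apply: recursive_computable; rewrite /recursive1 /b.
  by move: rf (fun F => @recursive_comp1 _ F rowner); recursive.
(* The first component makes the marker test the program for [b]; the second forces [N < y], where
   [cover] applies. *)
have [y nYy yP] := marker_limit (pairn (enc c) N.+1).
have ltNy : N < y.
  rewrite -(yP y) //; apply: leq_trans (marker_ge _ _).
  exact: leq_trans (leq_addl _ _) (leq_pairn _ _).
have [by_|nby] := boolP (b y).
  (* [y] is in W, so the program of its marker, which computes [b], outputs 0 on [y], against
     [b y]. *)
  have /andP[_ /eqP/code_enters[s /andP[les /bexP[k _ /andP[/eqP Ek /bexP[t _]]]]]] := by_.
  have -> : k = pairn (enc c) N.+1 by apply: (@marker_inj s); rewrite Ek yP.
  rewrite fstn_pairn => /andP[/halts_sound/cP + /eqP E].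
  by rewrite E by_.
(* The output 0 puts [y] into W, so some [x] is sent to the set of [y] alone; by [cover] this [x]
   owns [y], whence [b y]. *)
have /halts_complete[t h E] : eval c [:: y] 0 by apply/cP; rewrite (negbTE nby).
have [x Ex] : exists x, code_of x = 2 ^ y.
  apply: (@enters_code _ (maxn y t)); rewrite /enters leq_maxl.
  have Em := yP (maxn y t) (leq_maxl _ _).
  apply/bexP; exists (pairn (enc c) N.+1).
    by rewrite ltnS -[leqRHS]Em marker_ge.
  rewrite Em eqxx; apply/bexP; exists t; first by rewrite ltnS leq_maxr.
  by rewrite fstn_pairn h E.
have Dy := cover x y ltNy nYy Ex.
by move: nby; rewrite /b (ownerP _ _ Dy) Ex eqxx andbT; move/negP; apply.
Qed.

End Reduction.

Theorem theorem3p4 :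
  exists X Y : set nat,
    [/\ ce_set X, ce_set Y, le_c1 X Y & ~ le_c1N X Y].
Proof.
exists X, Y; split; [exact: ce_X|exact: ce_Y|exact: c1_X_Y|].
by move=> [f [c1f]]; exact: c1_noncomputable_range.
Qed.
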